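(* Let $\delta>0$ and let $C:\mathbb{F}_2^m\to\mathbb{F}_2^n$ be a linear map that gives a $3$-query locally decodable code with distance $\delta$. Then $m\le K n^{1/3}\log n$ for $K=10^7/\delta^2$.
   Context: All logarithms are base 2. For $y,z\in\mathbb{F}_2^n$, $\mathrm{dist}(y,z)$ denotes the fraction of coordinates in which $y$ and $z$ differ. A map $C:\{0,1\}^m\to\{0,1\}^n$ is a $q$-query locally decodable code with distance $\delta$ if there is a randomized local decoding algorithm which, given any index $i\in[m]$ and any $y\in\{0,1\}^n$ with $\mathrm{dist}(y,C(x))\le\delta$ for some $x\in\{0,1\}^m$, reads at most $q$ coordinates of $y$ and outputs $x_i$ correctly with high probability over the choice of the queried coordinates. The code is linear if $C$ is $\mathbb{F}_2$-linear when viewed as a map $\mathbb{F}_2^m\to\mathbb{F}_2^n$.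
   Formalization: The theorem assumes n > 1: for n = 1 the bound reads m ≤ 0, which the identity code on F_2 (m = n = 1, δ = 1/2) violates, and for n = 0 the logarithm and the distance are undefined. *)

(* Defs.v *)
From HB Require Import structures.
From mathcomp Require Import all_boot all_order all_algebra.
From mathcomp Require Import all_classical all_reals all_analysis.

Set Implicit Arguments.
Unset Strict Implicit.
Unset Printing Implicit Defensive.

Import Order.TTheory GRing.Theory Num.Theory.
Local Open Scope ring_scope.

Definition log2 (R : realType) (x : R) : R := ln x / ln 2.

Definition dist (R : realType) (n : nat) (y z : 'rV['F_2]_n) : R :=
  #|[set j : 'I_n | y 0 j != z 0 j]%SET|%:R / n%:R.

(* One run of a decoder, once its coins are fixed, is a decision tree: it may
   choose the next coordinate to read according to the values already read.
   Non-adaptive decoders are those whose choices ignore these values. *)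
Inductive decision_tree (n : nat) : Type :=
  | Output of 'F_2
  | Read of 'I_n & ('F_2 -> decision_tree n).

Fixpoint output (n : nat) (t : decision_tree n) (y : 'rV['F_2]_n) : 'F_2 :=
  match t with
  | Output b => b
  | Read j k => output (k (y 0 j)) y
  end.

Fixpoint coords_read (n : nat) (t : decision_tree n) (y : 'rV['F_2]_n)
    : {set 'I_n} :=
  match t with
  | Output _ => finset.set0
  | Read j k => (j |: coords_read (k (y 0 j)) y)%SET
  end.

Definition is_distribution (R : realType) (W : finType) (mu : W -> R) : Prop :=
  (forall w, 0 <= mu w) /\ \sum_w mu w = 1.

(* [p] is the success probability of the decoder. Its coins range over a finite
   probability space; this loses no generality, since for fixed [n] and [q]
   there are finitely many decision trees that never read a coordinate twice. *)
Definition locally_decodable (R : realType) (q : nat) (delta p : R)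
    (m n : nat) (C : 'rV['F_2]_m -> 'rV['F_2]_n) : Prop :=
  exists (W : finType) (mu : W -> R) (decoder : 'I_m -> W -> decision_tree n),
    is_distribution mu /\
    forall (i : 'I_m) (x : 'rV['F_2]_m) (y : 'rV['F_2]_n),
      dist R y (C x) <= delta ->
      (forall w, (#|coords_read (decoder i w) y| <= q)%N) /\
      p <= \sum_(w | output (decoder i w) y == x 0 i) mu w.

(* Main.v *)
Require Import Defs.
From HB Require Import structures.
From mathcomp Require Import all_boot all_order all_algebra.
From mathcomp Require Import all_classical all_reals all_analysis.
From mathcomp Require Import ring lra zify.

Set Implicit Arguments.
Unset Strict Implicit.
Unset Printing Implicit Defensive.

Import Order.TTheory GRing.Theory Num.Theory.
Local Open Scope ring_scope.

(* Linearity turns the decoder into combinatorics: if fewer than [delta n]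
   coordinates are erased, the surviving columns of [C] still contain at most
   three that sum to [e_i]. Taking such sets greedily gives, for each [i], at
   least [delta n / 3] disjoint triples whose columns sum to [e_i] (after padding
   by zero columns); [s_i] denotes the rotation of these triples.

   A graph whose vertices carry vectors of [F_2^m], and in which every vertex has
   at most [D] edges changing a given coordinate, has average degree
   [O(D log N)]. Applied to pairs lying in more than [O(log n)] triples this
   discards few triples. Applied to the Kikuchi graph on pairs of sequences of
   length [l], where two triples [{u, a, b}] and [{u, c, d}] of different colours
   allow one to replace an [a] by [b] in the first sequence and a [c] by [d] in
   the second, it gives the theorem with [l ~ delta^2 m / log n], once the edges
   at vertices of exceptionally large colour degree are removed. *)

(** * Base-2 logarithms and the splitting inequality for [k log2 k] *)

Section Log2.
Variable R : realType.
Implicit Types x y : R.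

Lemma ln2_gt0 : 0 < ln (2 : R).
Proof. by rewrite ln_gt0 // ltr1n. Qed.

Lemma log2_le x y : 0 < x -> x <= y -> log2 x <= log2 y.
Proof.
move=> x0 xy; rewrite /log2 ler_pM2r ?invr_gt0 ?ln2_gt0 //.
by rewrite ler_ln ?posrE //; exact: lt_le_trans xy.
Qed.

Lemma log2M x y : 0 < x -> 0 < y -> log2 (x * y) = log2 x + log2 y.
Proof. by move=> x0 y0; rewrite /log2 lnM ?posrE // mulrDl. Qed.

Lemma log2X x k : 0 < x -> log2 (x ^+ k) = k%:R * log2 x.
Proof. by move=> x0; rewrite /log2 lnXn // -[ln x *+ k]mulr_natl mulrA. Qed.

Lemma log2_2 : log2 (2 : R) = 1.
Proof. by rewrite /log2 divff // gt_eqF // ln2_gt0. Qed.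

Lemma log2_nat_ge0 (k : nat) : 0 <= log2 (k%:R : R).
Proof.
case: k => [|k]; first by rewrite /log2 ln0 // mul0r.
by rewrite /log2 divr_ge0 ?ln_ge0 ?ler1n // ltW // ln2_gt0.
Qed.

(** This drives the induction for a bound of the form [k log2 k]. Since [2 a <= a + b], each element
    of the smaller part gains a full bit when the parts are merged, and this gain of [a] pays for
    the edges cut. *)
Lemma log2_nat_split (a b : nat) : (a <= b)%N ->
  a%:R + a%:R * log2 (a%:R : R) + b%:R * log2 (b%:R : R)
    <= (a + b)%:R * log2 ((a + b)%:R : R).
Proof.
move=> leab; rewrite natrD mulrDl lerD //.
  case: a leab => [|a] leab; first by rewrite !mul0r addr0.
  have l2 : log2 (2 * a.+1%:R : R) = 1 + log2 (a.+1%:R : R).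
    by rewrite log2M // log2_2.
  rewrite -[X in X + _]mulr1 -mulrDr -l2 ler_wpM2l //.
  apply: log2_le; first by rewrite mulr_gt0.
  by rewrite -natrD -natrM ler_nat; lia.
case: b leab => [|b] leab; first by rewrite !mul0r.
by rewrite ler_wpM2l //; apply: log2_le; rewrite // lerDr.
Qed.

End Log2.

(** * Edge isoperimetry for graphs labelled by vectors over F_2 *)

(* Cut along one coordinate after another: each cut separates a part [A0] with
   at most half of the vertices, and severs at most [2 D #|A0|] edges. *)
Lemma edge_isoperimetry (R : realType) (X E : finType) (m : nat)
    (f : X -> 'rV['F_2]_m) (src tgt : E -> X) (P : {set E}) (D : R) :
  0 <= D ->
  (forall x k, #|[set e in P | (src e == x) &&
      (f (src e) 0 k != f (tgt e) 0 k)]|%:R <= D) ->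
  (forall x k, #|[set e in P | (tgt e == x) &&
      (f (src e) 0 k != f (tgt e) 0 k)]|%:R <= D) ->
  (forall e, e \in P -> f (src e) != f (tgt e)) ->
  forall A : {set X},
  #|[set e in P | (src e \in A) && (tgt e \in A)]|%:R
    <= 2 * D * (#|A|%:R * log2 (#|A|%:R : R)).
Proof.
move=> D0 Ds Dt neP A.
have degA (F : E -> X) k (B : {set X}) :
    (forall x, #|[set e in P | (F e == x) &&
      (f (src e) 0 k != f (tgt e) 0 k)]|%:R <= D) ->
    #|[set e in P | (F e \in B) && (f (src e) 0 k != f (tgt e) 0 k)]|%:R
      <= D * #|B|%:R.
  move=> DF.
  have -> : #|[set e in P | (F e \in B) && (f (src e) 0 k != f (tgt e) 0 k)]|
      = (\sum_(x in B) #|[set e in P | (F e == x) &&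
          (f (src e) 0 k != f (tgt e) 0 k)%R]|)%N.
    rewrite -sum1_card (partition_big F (mem B)) /=; last first.
      by move=> e; rewrite !inE => /and3P[].
    apply: eq_bigr => x xB; rewrite -sum1_card; apply: eq_bigl => e.
    rewrite !inE; case: (F e =P x) => [->|]; rewrite ?xB ?andbT ?andbF //.
  rewrite natr_sum mulr_natr -sumr_const.
  by apply: ler_sum => x _; exact: DF.
(* The list [s] holds the coordinates still to be cut; on [B] all others are constant. When [s] is
   empty, [f] is constant on [B], so no edge of [P] has both ends there. *)
suff H (s : seq 'I_m) : forall B : {set X},
    (forall x y k, x \in B -> y \in B -> k \notin s -> f x 0 k = f y 0 k) ->
    #|[set e in P | (src e \in B) && (tgt e \in B)]|%:R
      <= 2 * D * (#|B|%:R * log2 (#|B|%:R : R)).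
  by apply: (H (enum 'I_m)) => x y k _ _; rewrite mem_enum.
elim: s => [|k s IHs] B fB.
  rewrite (_ : [set e in P | _] = finset.set0).
    rewrite cards0 mulr_ge0 //; first exact: mulr_ge0.
    by apply: mulr_ge0 => //; exact: log2_nat_ge0.
  apply/setP => e; rewrite !inE; apply/negP => /and3P[eP sB tB].
  by move/eqP: (neP e eP); apply; apply/rowP => k; exact: fB.
pose Bb b := [set x in B | (f x 0 k == 0) == b].
have Bbin b x : x \in Bb b -> x \in B by rewrite inE => /andP[].
have Bbf b x y : x \in Bb b -> y \in Bb b -> f x 0 k = f y 0 k.
  have F2 (z t : 'F_2) : (z == 0) = (t == 0) -> z = t.
    by case: z t => [[|[|?]] ?] [[|[|?]] ?] // _; exact: val_inj.
  by rewrite !inE => /andP[_ /eqP xb] /andP[_ /eqP yb]; apply: F2; rewrite xb yb.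
have {}IH b : #|[set e in P | (src e \in Bb b) && (tgt e \in Bb b)]|%:R
      <= 2 * D * (#|Bb b|%:R * log2 (#|Bb b|%:R : R)).
  apply: IHs => x y k' xB yB k's; have [->|nkk] := eqVneq k' k.
    exact: Bbf xB yB.
  by apply: fB; rewrite ?(Bbin _ _ xB) ?(Bbin _ _ yB) // inE negb_or nkk.
have cB b : (#|Bb b| + #|Bb (~~ b)| = #|B|)%N.
  rewrite -cardsUI (_ : Bb b :&: _ = finset.set0) ?cards0 ?addn0.
    apply: eq_card => x; rewrite !inE.
    by case: (x \in B); case: (f x 0 k == 0); case: b.
  apply/setP => x; rewrite !inE.
  by case: (x \in B); case: (f x 0 k == 0); case: b.
have [b leb] : exists b, (#|Bb b| <= #|Bb (~~ b)|)%N.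
  by case: (leqP #|Bb true| #|Bb false|) => h; [exists true|exists false; exact: ltnW].
pose cut F := [set e in P | (F e \in Bb b) && (f (src e) 0 k != f (tgt e) 0 k)].
have sub : (#|[set e in P | (src e \in B) && (tgt e \in B)]| <=
    #|[set e in P | (src e \in Bb b) && (tgt e \in Bb b)]| +
    #|[set e in P | (src e \in Bb (~~ b)) && (tgt e \in Bb (~~ b))]| +
    (#|cut src| + #|cut tgt|))%N.
  apply: leq_trans (leq_add (leq_card_setU _ _) (leq_card_setU _ _)).
  apply: leq_trans (leq_card_setU _ _).
  apply: subset_leq_card; apply/fintype.subsetP => e; rewrite !inE.
  move=> /and3P[eP -> ->]; rewrite eP /=.
  case: (boolP ((f (src e) 0 k == 0) == (f (tgt e) 0 k == 0))) => [/eqP ->|].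
    by case: (f (tgt e) 0 k == 0); case: b {leb cut}.
  have [->|_] := eqVneq (f (src e) 0 k) (f (tgt e) 0 k); first by rewrite eqxx.
  by case: (f (src e) 0 k == 0); case: (f (tgt e) 0 k == 0); case: b {leb cut}.
have := log2_nat_split R leb; rewrite cB => sp.
move: sub; rewrite -(ler_nat R) !natrD => sub.
have cs := degA src k (Bb b) (Ds^~ k).
have ct := degA tgt k (Bb b) (Dt^~ k).
have := IH b; have := IH (~~ b).
have := ler_wpM2l (mulr_ge0 (ler0n R 2) D0) sp.
move: sub cs ct; rewrite /cut; lra.
Qed.

(** * From a local decoder to small sets of columns spanning [e_i] *)

Lemma run_eq_on_coords_read (n : nat) (t : decision_tree n)
    (y y' : 'rV['F_2]_n) :
  (forall j, j \in coords_read t y -> y' 0 j = y 0 j) ->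
  coords_read t y' = coords_read t y /\ output t y' = output t y.
Proof.
elim: t => [b|j k IHk] //= yy'.
have -> : y' 0 j = y 0 j by apply: yy'; rewrite !inE eqxx.
case: (IHk (y 0 j)) => [|-> ->] //.
by move=> j' j'in; apply: yy'; rewrite !inE j'in orbT.
Qed.

Lemma F2_neq0 (a : 'F_2) : a != 0 -> a = 1.
Proof. by case: a => [[|[|?]] ?] // _; exact: val_inj. Qed.

Section Columns.
Variables (m n : nat) (C : {linear 'rV['F_2]_m -> 'rV['F_2]_n}).

Definition column (j : 'I_n) : 'rV['F_2]_m := (col j (lin1_mx C))^T.

Lemma linear_columnE x j : C x 0 j = \sum_k x 0 k * column j 0 k.
Proof.
rewrite -mul_rV_lin1 mxE; apply: eq_bigr => k _.
by congr (_ * _); rewrite !mxE.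
Qed.

(** Linear duality: if [e_i] is outside the span of the selected columns, some column of the
    cokernel is orthogonal to all of them but not to [e_i]. Over F_2 a linear combination is a
    subset sum, whence the set [S']. *)
Lemma column_span_or_kernel (S : {set 'I_n}) (i : 'I_m) :
  (exists2 S' : {set 'I_n}, S' \subset S &
      \sum_(j in S') column j = delta_mx 0 i) \/
  (exists2 z : 'rV['F_2]_m, (forall j, j \in S -> C z 0 j = 0) & z 0 i = 1).
Proof.
pose A : 'M['F_2]_(n, m) := \matrix_(j, k) ((j \in S)%:R * column j 0 k).
have [/submxP[D eD]|] := boolP (delta_mx (0 : 'I_1) i <= A)%MS.
  left; exists [set j in S | D 0 j != 0]%SET.
    by apply/fintype.subsetP => j; rewrite inE => /andP[].
  rewrite eD; apply/rowP => k; rewrite summxE !mxE [LHS]big_mkcond.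
  apply: eq_bigr => j _; rewrite inE [A j k]mxE /=.
  case: (j \in S) => /=; last by rewrite mul0r mulr0.
  rewrite mul1r.
  have [->|/F2_neq0 ->] := eqVneq (D 0 j) 0; rewrite ?mul0r ?eqxx //=.
  by rewrite mul1r.
rewrite submxE => /eqP nz; right.
have [k nzk] : exists k, (delta_mx 0 i *m cokermx A) (0 : 'I_1) k != 0.
  apply/existsP; apply: contraT; rewrite negb_exists => /forallP H.
  by case: nz; apply/rowP => k; rewrite [RHS]mxE; apply/eqP; rewrite -[_ == _]negbK.
exists (col k (cokermx A))^T.
  move=> j jS; rewrite linear_columnE.
  have /matrixP/(_ j k) := mulmx_coker A; rewrite mxE [RHS]mxE => Az.
  rewrite -[RHS]Az; apply: eq_bigr => l _.
  by rewrite [A j l]mxE jS mul1r mulrC; congr (_ * _); rewrite !mxE.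
apply: F2_neq0; move: nzk; rewrite -rowE !mxE.
by congr (_ != _); rewrite !mxE.
Qed.

End Columns.

Section Decoding.
Variables (R : realType) (m n : nat) (C : {linear 'rV['F_2]_m -> 'rV['F_2]_n}).

(** Writing the constant 0 makes the erased positions independent of [x], while the word stays
    within [delta] of [C x] as long as [Z] has at most [delta n] elements. *)
Definition erase (Z : {set 'I_n}) (x : 'rV['F_2]_m) : 'rV['F_2]_n :=
  \row_j (if j \in Z then 0 else C x 0 j).

Lemma dist_erase (Z : {set 'I_n}) (delta : R) x : (0 < n)%N ->
  #|Z|%:R <= delta * n%:R -> dist R (erase Z x) (C x) <= delta.
Proof.
move=> n0 Zd; rewrite /dist ler_pdivrMr ?ltr0n //; apply: le_trans Zd.
rewrite ler_nat; apply: subset_leq_card; apply/fintype.subsetP => j.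
by rewrite inE mxE; case: (j \in Z) => //; rewrite eqxx.
Qed.

(* If the columns outside [Z] read along each branch do not span [e_i], then
   translating [x] by a vector orthogonal to those columns fixes the run and
   flips [x_i], so the output is right for exactly half of the inputs. *)
Lemma output_half (Z : {set 'I_n}) (i : 'I_m) (t : decision_tree n) :
  (forall x, exists2 z : 'rV['F_2]_m,
     (forall j, j \in coords_read t (erase Z x) :\: Z -> C z 0 j = 0) &
     z 0 i = 1) ->
  (#|[set x | output t (erase Z x) == x 0%R i]%SET|.*2 = #|{: 'rV['F_2]_m}|)%N.
Proof.
move=> Hz.
pose good S (z : 'rV['F_2]_m) :=
  [forall j in S :\: Z, C z 0 j == 0] && (z 0 i == 1).
(* The translation is chosen as a function of the set read, not of [x]. The run is unchanged by the
   translation, so the same vector is picked again and [phi] is an involution. By [zP] the default 0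
   never occurs for the sets [S x]. *)
pose z S : 'rV['F_2]_m := odflt 0 [pick z | good S z].
pose S x := coords_read t (erase Z x).
have zP x : good (S x) (z (S x)).
  rewrite /z; case: pickP => //= none.
  have [z0 z0S z0i] := Hz x.
  have : good (S x) z0.
    rewrite /good z0i eqxx andbT; apply/forall_inP => j jS.
    by rewrite z0S.
  by rewrite none.
pose phi x := x + z (S x).
have run x : coords_read t (erase Z (phi x)) = S x /\
    output t (erase Z (phi x)) = output t (erase Z x).
  apply: run_eq_on_coords_read => j jS; rewrite !mxE.
  case: ifPn => // jZ; rewrite linearD mxE.
  have /andP[/forall_inP/(_ j) + _] := zP x.
  by rewrite inE jZ jS => /(_ isT)/eqP ->; rewrite addr0.
have F2dbl (a : 'F_2) : a + a = 0 by case: a => [[|[|?]] ?] //; exact: val_inj.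
have phiK : involutive phi.
  move=> x; change (phi x + z (S (phi x)) = x).
  have -> : S (phi x) = S x := (run x).1.
  rewrite /phi -addrA.
  by apply/rowP => k; rewrite !mxE F2dbl addr0.
have phii x : (output t (erase Z (phi x)) == phi x 0 i)
    = ~~ (output t (erase Z x) == x 0 i).
  rewrite (run x).2 mxE; have /andP[_ /eqP ->] := zP x.
  case: (output _ _) => [[|[|?]] ?] //; case: (x 0 i) => [[|[|?]] ?] //.
rewrite -addnn -[X in _ = X](cardsC [set x | output t (erase Z x) == x 0 i]%SET).
congr (_ + _)%N; rewrite -(card_imset _ (inv_inj phiK)).
apply: eq_card => x; rewrite !inE; apply/imsetP/idP => [[x' + ->]|H].
  by rewrite inE phii negbK.
by exists (phi x); rewrite ?phiK // inE phii.
Qed.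

(** Without such a set, every choice of coins decodes exactly half of the inputs [x] correctly from
    [erase Z x]. Averaging over [x] and exchanging the sums gives success probability at most 1/2
    for some [x], against [1 / 2 < p]. *)
Lemma decodable_span (delta p : R) : 1 / 2 < p -> (0 < n)%N ->
  locally_decodable 3 delta p C ->
  forall (i : 'I_m) (Z : {set 'I_n}), #|Z|%:R <= delta * n%:R ->
  exists S : {set 'I_n}, [/\ (#|S| <= 3)%N, [disjoint S & Z] &
    \sum_(j in S) column C j = delta_mx 0 i].
Proof.
move=> p2 n0 [W [mu [dec [[mu0 mu1] decP]]]] i Z Zd.
apply: contrapT => nS.
have half w : (#|[set x | output (dec i w) (erase Z x) == x 0%R i]%SET|.*2
    = #|{: 'rV['F_2]_m}|)%N.
  apply: output_half => x.
  have [[S SS eS]|//] :=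
    column_span_or_kernel C (coords_read (dec i w) (erase Z x) :\: Z) i.
  case: nS; exists S; split=> //.
    have [+ _] := decP i x (erase Z x) (dist_erase x n0 Zd) => /(_ w).
    apply: leq_trans; apply: subset_leq_card.
    by apply: fintype.subset_trans SS _; exact: subsetDl.
  by move: SS; rewrite finset.subsetD => /andP[].
have H : \sum_(x : 'rV['F_2]_m) p <=
    \sum_x \sum_(w | output (dec i w) (erase Z x) == x 0 i) mu w.
  apply: ler_sum => x _.
  by have [_ ] := decP i x (erase Z x) (dist_erase x n0 Zd).
move: H; rewrite sumr_const.
rewrite (exchange_big_dep predT) //=.
under eq_bigr => w _.
  rewrite (_ : \sum_(x | _) mu w = #|{: 'rV['F_2]_m}|%:R / 2 * mu w).
    over.
  rewrite sumr_const -(half w) -mul2n natrM [2 * _]mulrC mulfK ?pnatr_eq0 //.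
  by rewrite mulr_natl; congr (_ *+ _); apply: eq_card => x; rewrite !inE.
rewrite -mulr_sumr mu1 mulr1 => H.
have c0 : 0 < #|{: 'rV['F_2]_m}|%:R :> R.
  by rewrite ltr0n; apply/card_gt0P; exists 0.
move: H; rewrite -mulr_natl; set c := _%:R => H.
by have := ltr_pM2l c0 (1 / 2) p; rewrite p2 -/c; move: H; lra.
Qed.

End Decoding.

(** * Counting sequences with prescribed entries *)

Section PinnedSequences.
Variables (V : finType) (l : nat).
Local Notation n := #|V|.
Implicit Types (a b : V) (p q : 'I_l).

Lemma card_pin p a :
  (n * #|[set S : {ffun 'I_l -> V} | S p == a]| = n ^ l)%N.
Proof.
pose F i : pred V := if i == p then pred1 a else predT.
have -> : #|[set S : {ffun 'I_l -> V} | S p == a]| = (\prod_i #|F i|)%N.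
  have := card_family F; rewrite foldrE big_image => <-; apply: eq_card => S; rewrite inE.
  apply/eqP/familyP => [Sp i|/(_ p)]; rewrite /F.
    by case: eqP => [->|//]; rewrite inE /= Sp.
  by rewrite eqxx => /eqP.
rewrite (bigD1 p) //= {1}/F eqxx card1 mul1n.
rewrite (eq_bigr (fun=> n)); last by move=> i; rewrite /F => /negPf ->.
rewrite prod_nat_const -[in LHS](expn1 n) -expnD.
congr (_ ^ _)%N; rewrite add1n -[RHS]card_ord [in RHS](cardD1 p) inE.
by congr _.+1; apply: eq_card => i; rewrite !inE andbT.
Qed.

Lemma card_pin2 p q a b : p != q ->
  (n ^ 2 * #|[set S : {ffun 'I_l -> V} | (S p == a) && (S q == b)]| = n ^ l)%N.
Proof.
move=> pq.
pose F i : pred V := if i == p then pred1 a else if i == q then pred1 b else predT.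
have -> : #|[set S : {ffun 'I_l -> V} | (S p == a) && (S q == b)]|
    = (\prod_i #|F i|)%N.
  have := card_family F; rewrite foldrE big_image => <-; apply: eq_card => S; rewrite inE.
  apply/andP/familyP => [[/eqP Sp /eqP Sq] i|H]; rewrite /F.
    by case: eqP => [->|_]; [|case: eqP => [->|//]]; rewrite inE /= ?Sp ?Sq.
  have := H p; have := H q; rewrite /F !eqxx eq_sym (negPf pq).
  by rewrite !inE.
rewrite (bigD1 p) // (bigD1 q) ?[q == p]eq_sym //= {1 2}/F !eqxx.
rewrite eq_sym (negPf pq) !card1 !mul1n.
rewrite (eq_bigr (fun=> n)); last first.
  by move=> i /andP[/negPf ip /negPf iq]; rewrite /F ip iq.
rewrite prod_nat_const -expnD; congr (_ ^ _)%N.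
rewrite -[RHS]card_ord [in RHS](cardD1 p) [in RHS](cardD1 q) !inE /= [q == p]eq_sym pq.
by congr _.+2; apply: eq_card => i; rewrite !inE andbT andbC.
Qed.

(** Given [S p = a], a position other than [p] holds [b] with probability [1 / n], and [p] itself
    does so only if [a = b]. The counts are multiplied by powers of [n] to avoid division. *)
Lemma sum_pin p a b :
  (n ^ 2 * \sum_(S : {ffun 'I_l -> V} | S p == a) \sum_q (S q == b)
    <= n ^ l * (l + n * (a == b)))%N.
Proof.
rewrite exchange_big /= big_distrr /=.
have H q : (n ^ 2 * \sum_(S : {ffun 'I_l -> V} | S p == a) (S q == b)
    <= n ^ l * (1 + (q == p) * (n * (a == b))))%N.
  have -> : (\sum_(S : {ffun 'I_l -> V} | S p == a) (S q == b)
      = #|[set S : {ffun 'I_l -> V} | (S p == a) && (S q == b)]|)%N.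
    rewrite -sum1_card big_mkcond [RHS]big_mkcond; apply: eq_bigr => S _.
    by rewrite inE; case: (S p == a) (S q == b) => [] [].
  have [->|qp] := eqVneq q p; last first.
    by rewrite card_pin2 1?eq_sym //= mul0n addn0 muln1.
  rewrite mul1n; have [->|ab] := eqVneq a b.
    rewrite (_ : [set S | _] = [set S : {ffun 'I_l -> V} | S p == b]%SET).
      by rewrite -mulnA card_pin muln1 mulnC leq_mul2l leq_addl orbT.
    by apply/setP => S; rewrite !inE andbb.
  rewrite (_ : [set S | _] = finset.set0) ?cards0 ?muln0 //.
  apply/setP => S; rewrite !inE; apply/negP => /andP[/eqP -> /eqP ba].
  by rewrite ba eqxx in ab.
apply: leq_trans.
  by apply: leq_sum => q _; exact: H.
rewrite -big_distrr /= leq_mul2l big_split /= sum1_card card_ord; apply/orP; right.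
rewrite leq_add2l -big_distrl /= (bigD1 p) //= eqxx big1 ?addn0 ?mul1n //.
by move=> i /negPf ->.
Qed.

(** The two sequences are independent, so for each label the sum factors into two instances of
    [sum_pin]. *)
Lemma sum_pin_labels (T : finType) (L : {set T}) (alpha beta : T -> V)
    p q a c :
  (n ^ 4 * \sum_(S : {ffun 'I_l -> V} * {ffun 'I_l -> V} |
             (S.1 p == a) && (S.2 q == c))
             \sum_(t in L) \sum_p' \sum_q'
               ((S.1 p' == alpha t) && (S.2 q' == beta t))
   <= n ^ (2 * l) *
      \sum_(t in L) (l + n * (a == alpha t)) * (l + n * (c == beta t)))%N.
Proof.
rewrite exchange_big /= !big_distrr /=; apply: leq_sum => t _.
have -> : (\sum_(S : {ffun 'I_l -> V} * {ffun 'I_l -> V} |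
      (S.1 p == a) && (S.2 q == c))
     \sum_p' \sum_q' ((S.1 p' == alpha t) && (S.2 q' == beta t))
   = (\sum_(S : {ffun 'I_l -> V} | S p == a) \sum_p' (S p' == alpha t)) *
     (\sum_(S : {ffun 'I_l -> V} | S q == c) \sum_q' (S q' == beta t)))%N.
  rewrite big_distrl /= -(pair_big_dep (fun S : {ffun 'I_l -> V} => S p == a)
    (fun _ (S : {ffun 'I_l -> V}) => S q == c) (fun S1 S2 : {ffun 'I_l -> V} =>
    \sum_p' \sum_q' ((S1 p' == alpha t) && (S2 q' == beta t)))%N) /=.
  apply: eq_bigr => S1 _; rewrite big_distrr; apply: eq_bigr => S2 _.
  rewrite big_distrl; apply: eq_bigr => p' _.
  by rewrite big_distrr; apply: eq_bigr => q' _ /=; rewrite mulnb.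
rewrite (_ : 4 = 2 + 2)%N // mul2n -addnn !expnD mulnACA [leqRHS]mulnACA.
by apply: leq_mul; exact: sum_pin.
Qed.

End PinnedSequences.

(** * Triple systems and their greedy construction *)

(* A partial matching of [V] into triples [{x, s x, s (s x)}] whose vectors sum
   to [e_i]; a fixed point of [s] stands for a vector equal to [e_i]. *)
Definition triple_system (V : finType) (m : nat) (v : V -> 'rV['F_2]_m)
    (i : 'I_m) (U : {set V}) (s : V -> V) : Prop :=
  forall x, x \in U ->
    [/\ s x \in U, s (s (s x)) = x &
        v x + v (s x) + v (s (s x)) = delta_mx 0 i].

Lemma triple_system_extend (V : finType) (m : nat) (v : V -> 'rV['F_2]_m)
    (i : 'I_m) (U : {set V}) (s : V -> V) (x y z : V) :
  triple_system v i U s ->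
  x \notin U -> y \notin U -> z \notin U ->
  (x = y /\ y = z) \/ uniq [:: x; y; z] ->
  v x + v y + v z = delta_mx 0 i ->
  exists s', triple_system v i ([set x; y; z] :|: U) s'.
Proof.
move=> Us xU yU zU xyz vxyz.
pose s' w := if w == x then y else if w == y then z else if w == z then x else s w.
have s'x : s' x = y by rewrite /s' eqxx.
have s'y : s' y = z.
  rewrite /s' eqxx; case: xyz => [[-> ->]|]; first by rewrite eqxx.
  by rewrite /= !inE eq_sym; case: eqP.
have s'z : s' z = x.
  rewrite /s' eqxx; case: xyz => [[-> ->]|]; first by rewrite eqxx.
  rewrite /= !inE negb_or [x == z]eq_sym [y == z]eq_sym => /and3P[/andP[_ +] + _].
  by move=> /negPf -> /negPf ->.
have s'U w : w \in U -> s' w = s w.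
  move=> wU; rewrite /s'; case: eqP => [wx|_]; first by rewrite -wx wU in xU.
  case: eqP => [wy|_]; first by rewrite -wy wU in yU.
  by case: eqP => [wz|//]; rewrite -wz wU in zU.
exists s' => w; rewrite !inE -!orbA => /or4P[/eqP ->|/eqP ->|/eqP ->|wU].
- by rewrite s'x s'y s'z eqxx orbT.
- by rewrite s'y s'z s'x eqxx !orbT [_ + v x]addrC addrA.
- by rewrite s'z s'x s'y eqxx -addrA addrC.
have [sU ssU vU] := Us w wU; have [ssU' _ _] := Us _ sU.
by rewrite (s'U w wU) (s'U _ sU) (s'U _ ssU') sU !orbT.
Qed.

(* The pairs [(a, true)] carry the zero vector; they pad decoding sets of size
   two to triples. *)
Definition padded_column (m n : nat) (C : {linear 'rV['F_2]_m -> 'rV['F_2]_n})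
    (x : 'I_n * bool) : 'rV['F_2]_m :=
  if x.2 then 0 else column C x.1.

Lemma decoding_triple_system (R : realType) (m n : nat)
    (C : {linear 'rV['F_2]_m -> 'rV['F_2]_n}) (i : 'I_m) (c : R) :
  (forall Z : {set 'I_n}, #|Z|%:R <= c ->
    exists S : {set 'I_n}, [/\ (#|S| <= 3)%N, [disjoint S & Z] &
      \sum_(j in S) column C j = delta_mx 0 i]) ->
  exists U s, triple_system (padded_column C) i U s /\ c < #|U|%:R.
Proof.
move=> span.
(* Greedy stages: stage [k] has at least [k] points unless more than [c] are already covered, so
   stage [#|V| + 1] settles the claim. By the invariant on [(a, true)], erasing the coordinates [a]
   with [(a, false)] in [U] makes both copies of every new coordinate free. *)
suff H k : exists U s, [/\ triple_system (padded_column C) i U s,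
    forall a, (a, true) \in U -> (a, false) \in U &
    (k <= #|U|)%N \/ c < #|U|%:R].
  have [U [s [Us _ [|//]]]] := H #|{: 'I_n * bool}|.+1; last by exists U, s.
  by rewrite ltnNge max_card.
elim: k => [|k [U [s [Us Ut kU]]]].
  exists finset.set0, id; split; last by left.
    by move=> x; rewrite inE.
  by move=> a; rewrite inE.
have [cU|Uc] := ltP c #|U|%:R; first by exists U, s; split=> //; right.
case: kU => [kU|]; last by rewrite ltNge Uc.
suff [x [y [z [xU yU zU xyz [vxyz xt yt zt]]]]] :
    exists x y z, [/\ x \notin U, y \notin U, z \notin U,
      (x = y /\ y = z) \/ uniq [:: x; y; z] &
      [/\ padded_column C x + padded_column C y + padded_column C z
        = delta_mx 0 i, ~~ x.2, ~~ y.2 & z.2 ==> (z == (x.1, true))]].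
  have [s' Us'] := triple_system_extend Us xU yU zU xyz vxyz.
  exists ([set x; y; z] :|: U), s'; split=> //.
    move=> a; rewrite !inE -!orbA => /or4P[/eqP ax|/eqP ay|/eqP az|/Ut aU].
    - by rewrite -ax in xt.
    - by rewrite -ay in yt.
    - move: zt; rewrite -az /= => /eqP[->].
      by rewrite (_ : (x.1, false) = x) ?inE ?eqxx //; case: (x) xt => ? [].
    - by rewrite aU !orbT.
  left; apply: leq_ltn_trans kU _; apply: proper_card.
  apply/properP; split; first exact: finset.subsetUr.
  by exists x => //; rewrite !inE eqxx.
have [|S [S3 SZ eS]] := span [set a | (a, false) \in U]%SET.
  apply: le_trans Uc; rewrite ler_nat.
  rewrite -(card_imset _ (f := fun a => (a, false))); last by move=> a b [].
  by apply: subset_leq_card; apply/fintype.subsetP => _ /imsetP[a + ->]; rewrite inE.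
have SU a : a \in S -> (a, false) \notin U.
  by move=> aS; have := disjointFr SZ aS; rewrite inE => ->.
have SUt a : a \in S -> (a, true) \notin U.
  by move=> aS; apply: contra (SU a aS); exact: Ut.
have inS a : (a \in S) = (a \in enum S) by rewrite mem_enum.
(* The empty set is impossible as [e_i] is nonzero. One column gives a fixed point, since three
   copies of [e_i] sum to [e_i]. Two columns are padded by [(a, true)], whose companion [(a, false)]
   is in the same triple, so the invariant survives. *)
move: eS S3 (enum_uniq S); rewrite -big_enum cardE.
case: (enum S) inS => [|a [|b [|d [|e r]]]] inS //= ; rewrite ?big_nil ?big_cons.
- move=> /rowP/(_ i); rewrite !mxE !eqxx => /eqP.
  by rewrite eq_sym oner_eq0.
- have aS : a \in S by rewrite inS !inE eqxx.
  rewrite big_nil addr0 => ea _ _.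
  exists (a, false), (a, false), (a, false); split; rewrite ?SU //; first by left.
  split=> //; rewrite /padded_column /= -ea -addrA.
  apply/rowP => k'; rewrite !mxE.
  rewrite (_ : forall t : 'F_2, t + t = 0) ?addr0 //.
  by case=> [[|[|?]] ?] //; exact: val_inj.
- have aS : a \in S by rewrite inS !inE eqxx.
  have bS : b \in S by rewrite inS !inE eqxx orbT.
  rewrite big_nil addr0 => eab _ ab.
  exists (a, false), (b, false), (a, true); split; rewrite ?SU ?SUt //.
    right; move: ab; rewrite /= !inE !xpair_eqE !eqxx.
    by case: (a == b); case: (b == a).
  by split=> //; rewrite /padded_column /= ?addr0 ?eqxx.
- have aS : a \in S by rewrite inS !inE eqxx.
  have bS : b \in S by rewrite inS !inE eqxx orbT.
  have dS : d \in S by rewrite inS !inE eqxx !orbT.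
  rewrite big_nil addr0 addrA => eabd _ abd.
  exists (a, false), (b, false), (d, false); split; rewrite ?SU //.
  by right; move: abd; rewrite /= !inE !xpair_eqE /= ?andbT.
Qed.

(** * Discarding the triples that contain a pair of large codegree *)

Lemma triple_system_inj (V : finType) (m : nat) (v : V -> 'rV['F_2]_m) i U s :
  triple_system v i U s -> {in U &, injective s}.
Proof.
move=> Us x y xU yU sxy; have [_ <- _] := Us x xU.
by rewrite sxy; have [_ -> _] := Us y yU.
Qed.

Definition codegree (V : finType) (m : nat) (U : 'I_m -> {set V})
    (r : 'I_m -> V -> V) (x y : V) : nat :=
  #|[set i | (x \in U i) && (r i x == y)]%SET|.

(* A pair [(x, y)] of large codegree is collapsed to one vertex carrying
   [v x + v y]; its triples become edges to their third points, each vertex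
   having at most one edge of each colour. *)
Lemma light_triple_system (R : realType) (V : finType) (m : nat)
    (v : V -> 'rV['F_2]_m) (U : 'I_m -> {set V}) (s : 'I_m -> V -> V) :
  (1 < #|V|)%N ->
  (forall i, triple_system v i (U i) (s i)) ->
  let L : R := log2 #|V|%:R in
  exists U' : 'I_m -> {set V},
    [/\ forall i, triple_system v i (U' i) (s i),
        forall x y, (codegree U' s x y)%:R <= 12 * L &
        (\sum_i #|U i|)%:R <= (\sum_i #|U' i|)%:R + 36 * #|V|%:R * L].
Proof.
move=> n2 Us L.
(* With [log2 #|A| <= 3 L], isoperimetry gives [#|P| <= 6 L (#|Hv| + #|V|)]. The threshold [12 L]
   gives [12 L #|Hv| <= #|P|], so the term in [Hv] is at most half of [#|P|] and
   [#|P| <= 12 #|V| L]. *)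
pose Hv := [set xy : V * V | 12 * L < (codegree U s xy.1 xy.2)%:R]%SET.
pose P := [set e : 'I_m * V | (e.2 \in U e.1) && ((e.2, s e.1 e.2) \in Hv)]%SET.
pose f (x : V * V + V) : 'rV['F_2]_m :=
  match x with inl xy => v xy.1 + v xy.2 | inr z => v z end.
pose src (e : 'I_m * V) : V * V + V := inl (e.2, s e.1 e.2).
pose tgt (e : 'I_m * V) : V * V + V := inr (s e.1 (s e.1 e.2)).
(* The vectors at the two ends of an edge of colour [i] differ by [e_i], so only coordinate [i]
   changes; this permits [D = 1] below. *)
have colour e k : e \in P -> f (src e) 0 k != f (tgt e) 0 k -> e.1 = k.
  rewrite inE => /andP[eU _]; have [_ _ /rowP/(_ k)] := Us _ _ eU.
  rewrite /= !mxE /=; have [->|nk] := eqVneq k e.1; first by [].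
  move=> H; case/negP; rewrite -subr_eq0; apply/eqP; rewrite -[RHS]H.
  by congr (_ + _); case: (v _ _ _) => [[|[|?]] ?] //; exact: val_inj.
have L0 : 0 <= L by exact: log2_nat_ge0.
have heavy : 12 * L * #|Hv|%:R <= #|P|%:R.
  have -> : #|P| = (\sum_(xy in Hv) codegree U s xy.1 xy.2)%N.
    rewrite -sum1_card.
    rewrite (partition_big (fun e => (e.2, s e.1 e.2)) (mem Hv)) /=; last first.
      by move=> e; rewrite inE => /andP[].
    apply: eq_bigr => -[x y] xyH; rewrite sum1_card /codegree /=.
    rewrite -[RHS](card_imset _ (f := fun i => (i, x))); last by move=> i j [].
    apply: eq_card => -[i z]; rewrite [LHS]unfold_in /= inE; apply/andP/imsetP.
      move=> [/andP[zU _] /eqP[zx sz]]; exists i; rewrite -zx //.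
      by rewrite inE zU sz eqxx.
    move=> [j]; rewrite inE => /andP[xU /eqP sx] [-> ->].
    by rewrite xU sx eqxx; move: xyH; rewrite inE => ->.
  rewrite natr_sum mulr_natr -sumr_const; apply: ler_sum => xy.
  by rewrite inE => /ltW.
pose A := (inl @: Hv :|: inr @: [set: V])%SET : {set V * V + V}.
have cA : #|A| = (#|Hv| + #|V|)%N.
  rewrite cardsU (_ : _ :&: _ = finset.set0) ?cards0 ?subn0.
    by rewrite !card_imset ?cardsT // => x y [].
  by apply/setP => x; rewrite !inE; apply/negP => /andP[/imsetP[? _ ->] /imsetP[? _]].
have PA : #|P|%:R <= 2 * 1 * (#|A|%:R * log2 (#|A|%:R : R)) :> R.
  have -> : P = [set e in P | (src e \in A) && (tgt e \in A)]%SET.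
    apply/setP => e; rewrite inE; case: (boolP (e \in P)) => //= eP.
    apply/esym/andP; split; apply/setUP.
      by left; apply: imset_f; move: eP; rewrite inE => /andP[].
    by right; exact: imset_f.
  apply: (edge_isoperimetry (f := f)) => //.
  - move=> x k; rewrite (ler_nat _ _ 1); apply/card_le1_eqP => e e'.
    rewrite inE => /andP[eP /andP[/eqP ex /(colour _ _ eP) ek]].
    rewrite inE => /andP[eP' /andP[/eqP ex' /(colour _ _ eP') ek']].
    rewrite [e]surjective_pairing [e']surjective_pairing ek ek'.
    by move: ex; rewrite -ex' => -[->].
  - move=> x k; rewrite (ler_nat _ _ 1); apply/card_le1_eqP => e e'.
    rewrite inE => /andP[eP /andP[/eqP ex /(colour _ _ eP) ek]].
    rewrite inE => /andP[eP' /andP[/eqP ex' /(colour _ _ eP') ek']].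
    rewrite [e]surjective_pairing [e']surjective_pairing ek ek'.
    move: ex eP eP'; rewrite -ex' !inE /tgt ek ek' => -[sss].
    move=> /andP[eU _] /andP[eU' _].
    have [_ + _] := Us _ _ eU; have [_ + _] := Us _ _ eU'.
    by rewrite sss => -> ->.
  - move=> e; rewrite inE => /andP[eU _].
    have [_ _ /rowP/(_ e.1)] := Us _ _ eU; rewrite !mxE !eqxx /=.
    move=> H; apply/eqP => /rowP/(_ e.1); rewrite /= !mxE => E.
    move: H; rewrite E; case: (v _ _ _) => [[|[|?]] ?] //.
have lA : log2 (#|A|%:R : R) <= 3 * L.
  rewrite -(log2X 3) ?ltr0n 1?ltnW //; apply: log2_le.
    by rewrite ltr0n cA addn_gt0 orbC ltnW.
  rewrite -natrX ler_nat cA.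
  have : (#|Hv| <= #|V| * #|V|)%N by rewrite -card_prod max_card.
  move: n2; rewrite !expnS expn0 muln1.
  by move: #|Hv| #|V| => h n n2 hn; nia.
have {PA heavy lA cA} PL : #|P|%:R <= 12 * #|V|%:R * L.
  have H : #|A|%:R * log2 (#|A|%:R : R) <= #|A|%:R * (3 * L) by rewrite ler_wpM2l.
  by move: H PA heavy; rewrite cA natrD; lra.
(* A point is dropped if any of the three rotations of its triple starts with a heavy pair; this
   keeps [U' i] closed under [s i]. Each element of [P] costs at most three points, whence
   [36 = 3 * 12]. *)
pose U' i := [set x in U i | [&& (i, x) \notin P, (i, s i x) \notin P &
   (i, s i (s i x)) \notin P]]%SET.
exists U'; split.
- move=> i x; rewrite inE => /and4P[xU P1 P2 P3]; have [sU sss vv] := Us i x xU.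
  by split=> //; rewrite inE sU P2 P3 sss P1.
- move=> x y; have [xyH|xyH] := boolP ((x, y) \in Hv).
    rewrite /codegree (_ : [set i | _]%SET = finset.set0) ?cards0.
      exact: mulr_ge0.
    apply/setP => i; rewrite !inE; apply/negP => /andP[/and4P[xU + _ _] /eqP sx].
    by rewrite xU /= sx; move: xyH; rewrite inE => ->.
  move: xyH; rewrite inE -leNgt /=; apply: le_trans; rewrite ler_nat.
  apply: subset_leq_card; apply/fintype.subsetP => i; rewrite !inE.
  by move=> /andP[/andP[-> _] ->].
pose Pi i := [set x | (i, x) \in P]%SET.
have sPi : (\sum_i #|Pi i| = #|P|)%N.
  rewrite -[RHS]sum1_card (partition_big fst predT) //=; apply: eq_bigr => i _.
  rewrite sum1_card -[LHS](card_imset _ (f := fun x => (i, x))); last by move=> ? ? [].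
  apply: eq_card => -[j x]; apply/imsetP/idP.
    by move=> [y]; rewrite inE => yP [-> ->]; rewrite unfold_in /= yP eqxx.
  by rewrite unfold_in /= => /andP[jP /eqP <-]; exists x => //; rewrite inE.
have H i : (#|U i| <= #|U' i| + 3 * #|Pi i|)%N.
  have pre (g : V -> V) : {in U i &, injective g} ->
      (#|[set x in U i | (i, g x) \in P]%SET| <= #|Pi i|)%N.
    move=> gI; rewrite -(card_in_imset (f := g)); last first.
      by move=> x y; rewrite !inE => /andP[xU _] /andP[yU _]; exact: gI.
    apply: subset_leq_card; apply/fintype.subsetP => _ /imsetP[x + ->].
    by rewrite !inE => /andP[].
  have c1 := pre id (fun _ _ _ _ => id).
  have c2 := pre (s i) (triple_system_inj (Us i)).
  have c3 : (#|[set x in U i | (i, s i (s i x)) \in P]%SET| <= #|Pi i|)%N.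
    apply: (pre (fun x => s i (s i x))) => x y xU yU.
    have [sx _ _] := Us i x xU; have [sy _ _] := Us i y yU.
    by move=> /(triple_system_inj (Us i) sx sy); exact: (triple_system_inj (Us i)).
  apply: leq_trans
    (leq_add (leqnn _) (leq_add c1 (leq_add c2 (leq_add c3 (leqnn 0))))).
  rewrite addn0.
  apply: leq_trans (leq_add (leqnn _) (leq_add (leqnn _) (leq_card_setU _ _))).
  apply: leq_trans (leq_add (leqnn _) (leq_card_setU _ _)).
  apply: leq_trans (leq_card_setU _ _).
  apply: subset_leq_card; apply/fintype.subsetP => x xU.
  have [p1|p1] := boolP ((i, x) \in P).
    by apply/setUP; right; apply/setUP; left; rewrite inE xU.
  have [p2|p2] := boolP ((i, s i x) \in P).
    by apply/setUP; right; apply/setUP; right; apply/setUP; left; rewrite inE xU.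
  have [p3|p3] := boolP ((i, s i (s i x)) \in P).
    by apply/setUP; right; apply/setUP; right; apply/setUP; right; rewrite inE xU.
  by apply/setUP; left; rewrite inE xU p1 p2 p3.
have {}H : (\sum_i #|U i| <= \sum_i (#|U' i| + 3 * #|Pi i|))%N by exact: leq_sum.
move: H; rewrite big_split -big_distrr /= sPi -(ler_nat R) natrD natrM.
by move: PL; lra.
Qed.

(** * Edges of the Kikuchi graph and the mean colour degree at an edge *)

Section Kikuchi.
Variables (R : realType) (V : finType) (m l : nat).
Variable U : 'I_m -> {set V}.
Local Notation n := #|V|.

(* A label [(u, i, j)] stands for two triples through [u], of colours
   [i] and [j]. *)
Local Notation label := (V * 'I_m * 'I_m)%type.
Local Notation state := ({ffun 'I_l -> V} * {ffun 'I_l -> V})%type.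
Local Notation edge := ('I_l * 'I_l * label * state)%type.

(** Equal colours are excluded: their two unit vectors would cancel, and the edge would join
    vertices carrying the same vector. *)
Definition labels : {set label} :=
  [set t | [&& t.1.1 \in U t.1.2, t.1.1 \in U t.2 & t.1.2 != t.2]]%SET.

Definition labels_at (k : 'I_m) : {set label} :=
  [set t in labels | (t.1.2 == k) || (t.2 == k)]%SET.

(** The map [r] is a parameter because it will be the rotation [s] for edges leaving a state and its
    square for edges entering one. *)
Definition applies (r : 'I_m -> V -> V) (y : 'I_l * 'I_l * label) (S : state) :=
  (S.1 y.1.1 == r y.2.1.2 y.2.1.1) && (S.2 y.1.2 == r y.2.2 y.2.1.1).

Definition edges (r : 'I_m -> V -> V) : {set edge} :=
  [set e | (e.1.2 \in labels) && applies r e.1 e.2]%SET.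

Definition colour_degree (r : 'I_m -> V -> V) (k : 'I_m) (S : state) : nat :=
  #|[set y : 'I_l * 'I_l * label | (y.2 \in labels_at k) && applies r y S]%SET|.

Lemma card_applies r y :
  (n ^ 2 * #|[set S | applies r y S]%SET| = n ^ (2 * l))%N.
Proof.
have -> : [set S | applies r y S]%SET =
    finset.setX [set S : {ffun 'I_l -> V} | S y.1.1 == r y.2.1.2 y.2.1.1]%SET
         [set S : {ffun 'I_l -> V} | S y.1.2 == r y.2.2 y.2.1.1]%SET.
  by apply/setP => S; rewrite !inE.
by rewrite cardsX expnS expn1 mulnACA !card_pin mul2n -addnn expnD.
Qed.

Lemma sum_edges r (F : edge -> nat) :
  (\sum_(e in edges r) F e =
   \sum_(y : 'I_l * 'I_l * label | y.2 \in labels)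
     \sum_(S | applies r y S) F (y, S))%N.
Proof.
rewrite pair_big_dep /=; apply: eq_big => [e|e _]; first by rewrite inE.
by rewrite -surjective_pairing.
Qed.

Lemma card_positions_labels :
  (\sum_(y : 'I_l * 'I_l * label | y.2 \in labels) 1 = l ^ 2 * #|labels|)%N.
Proof.
rewrite -(pair_big predT (mem labels) (fun=> fun=> 1%N)) /=.
by rewrite sum_nat_const sum1_card card_prod !card_ord.
Qed.

Lemma card_edges r : (n ^ 2 * #|edges r| = l ^ 2 * #|labels| * n ^ (2 * l))%N.
Proof.
rewrite -sum1_card sum_edges big_distrr /= -card_positions_labels big_distrl /=.
apply: eq_bigr => y _; rewrite mul1n -(card_applies r y); congr (_ * _)%N.
by rewrite sum1_card; apply: eq_card => S; rewrite !inE.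
Qed.

Section SecondMoment.
Variables (r : 'I_m -> V -> V) (Delta : R).
Hypothesis rI : forall i, {in U i &, injective (r i)}.
Hypothesis rD : forall x y, (codegree U r x y)%:R <= Delta.

(** One of the two colours is [k] and the other is free. Once both are known, [a] determines the
    common point by injectivity. *)
Lemma card_labels_at_fst k a :
  (#|[set t in labels_at k | r t.1.2 t.1.1 == a]%SET| <= 2 * m)%N.
Proof.
apply: (@leq_trans
  (#|[set t in labels | (t.1.2 == k) && (r t.1.2 t.1.1 == a)]%SET| +
   #|[set t in labels | (t.2 == k) && (r t.1.2 t.1.1 == a)]%SET|)).
  apply: leq_trans (leq_card_setU _ _); apply: subset_leq_card.
  apply/fintype.subsetP => t; rewrite 2!inE => /andP[/andP[tl tk] ra].
  by apply/setUP; case/orP: tk => tk; [left|right]; rewrite inE tl tk.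
rewrite mul2n -addnn; apply: leq_add.
  rewrite -[X in (_ <= X)%N]card_ord; apply: (leq_card_in snd).
  move=> [[u i] j] [[u' i'] j']; rewrite !inE /=.
  move=> /andP[/and3P[uU _ _] /andP[/eqP ? /eqP ru]].
  move=> /andP[/and3P[uU' _ _] /andP[/eqP ? /eqP ru']] <-; subst i i' a.
  by rewrite (rI uU uU').
rewrite -[X in (_ <= X)%N]card_ord; apply: (leq_card_in (fun t => t.1.2)).
move=> [[u i] j] [[u' i'] j']; rewrite !inE /=.
move=> /andP[/and3P[uU _ _] /andP[/eqP ? /eqP ru]].
move=> /andP[/and3P[uU' _ _] /andP[/eqP ? /eqP ru']] ii; subst j j' i' a.
by rewrite (rI uU uU').
Qed.

Lemma card_labels_at_snd k a :
  (#|[set t in labels_at k | r t.2 t.1.1 == a]%SET| <= 2 * m)%N.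
Proof.
pose g (t : label) : label := (t.1.1, t.2, t.1.2).
have gK : involutive g by case=> [[]].
apply: leq_trans (card_labels_at_fst k a).
rewrite -(card_imset _ (inv_inj gK)); apply: subset_leq_card.
apply/fintype.subsetP => _ /imsetP[[[u i] j] + ->]; rewrite !inE /=.
by rewrite eq_sym orbC => /andP[/andP[/and3P[-> -> ->] ->] ->].
Qed.

Lemma card_labels_at k : (#|labels_at k| <= 2 * m * n)%N.
Proof.
rewrite -sum1_card (partition_big (fun t => r t.1.2 t.1.1) predT) //=.
apply: (@leq_trans (\sum_(a : V) 2 * m)%N); last by rewrite sum_nat_const mulnC.
apply: leq_sum => a _; rewrite sum1_card; apply: leq_trans (card_labels_at_fst k a).
by apply: eq_leq; apply: eq_card => t; rewrite [in RHS]inE.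
Qed.

(** The colour [k] with the corresponding one of [a] and [c] determines the common point [u]. The
    other colour is then counted by the codegree of [u] with the remaining value, and this is where
    the light pairs enter. *)
Lemma card_labels_at_pair k a c :
  #|[set t in labels_at k | (r t.1.2 t.1.1 == a) && (r t.2 t.1.1 == c)]%SET|%:R
    <= 2 * Delta.
Proof.
set A := [set t in labels | (t.1.2 == k) &&
            ((r t.1.2 t.1.1 == a) && (r t.2 t.1.1 == c))]%SET.
set B := [set t in labels | (t.2 == k) &&
            ((r t.1.2 t.1.1 == a) && (r t.2 t.1.1 == c))]%SET.
apply: (@le_trans _ _ (#|A| + #|B|)%:R).
  rewrite ler_nat.
  apply: leq_trans (leq_card_setU _ _); apply: subset_leq_card.
  apply/fintype.subsetP => t; rewrite 2!inE => /andP[/andP[tl tk] ra].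
  by apply/setUP; case/orP: tk => tk; [left|right]; rewrite inE tl tk.
have Delta0 : 0 <= Delta by exact: le_trans (rD a a).
have -> : 2 * Delta = Delta + Delta by rewrite mulr_natl.
rewrite natrD; apply: lerD.
  have [->|[t0 t0A]] := set_0Vmem A; first by rewrite cards0.
  apply: le_trans (rD t0.1.1 c); rewrite ler_nat.
  have At t : t \in A -> t.1.1 = t0.1.1 /\ t.1.2 = t0.1.2.
    move: t0A; rewrite !inE => /andP[/and3P[U0 _ _] /and3P[/eqP k0 /eqP r0 _]].
    move=> /andP[/and3P[Ut _ _] /and3P[/eqP kt /eqP rt _]].
    rewrite kt in Ut rt *; rewrite k0 in U0 r0 *.
    by split=> //; apply: rI Ut U0 _; rewrite rt r0.
  rewrite -(card_in_imset (f := snd)); last first.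
    move=> t t' /At[e1 e2] /At[e1' e2'] e3.
    rewrite [t]surjective_pairing [t']surjective_pairing.
    rewrite [t.1]surjective_pairing [t'.1]surjective_pairing.
    by rewrite e1 e2 e1' e2' e3.
  apply: subset_leq_card; apply/fintype.subsetP => _ /imsetP[t tA ->].
  have [e1 _] := At t tA; move: tA; rewrite !inE -e1.
  by move=> /andP[/and3P[_ -> _] /and3P[_ _ ->]].
have [->|[t0 t0B]] := set_0Vmem B; first by rewrite cards0.
apply: le_trans (rD t0.1.1 a); rewrite ler_nat.
have Bt t : t \in B -> t.1.1 = t0.1.1 /\ t.2 = t0.2.
  move: t0B; rewrite !inE => /andP[/and3P[_ U0 _] /and3P[/eqP k0 _ /eqP r0]].
  move=> /andP[/and3P[_ Ut _] /and3P[/eqP kt _ /eqP rt]].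
  rewrite kt in Ut rt *; rewrite k0 in U0 r0 *.
  by split=> //; apply: rI Ut U0 _; rewrite rt r0.
rewrite -(card_in_imset (f := fun t => t.1.2)); last first.
  move=> t t' /Bt[e1 e2] /Bt[e1' e2'] e3.
  rewrite [t]surjective_pairing [t']surjective_pairing.
  rewrite [t.1]surjective_pairing [t'.1]surjective_pairing.
  by rewrite e1 e2 e1' e2' e3.
apply: subset_leq_card; apply/fintype.subsetP => _ /imsetP[t tB ->].
have [e1 _] := Bt t tB; move: tB; rewrite !inE -e1.
by move=> /andP[/and3P[-> _ _] /and3P[_ -> _]].
Qed.

Lemma colour_degreeE k S :
  colour_degree r k S = (\sum_(t in labels_at k) \sum_p \sum_q
    ((S.1 p == r t.1.2 t.1.1) && (S.2 q == r t.2 t.1.1)))%N.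
Proof.
rewrite /colour_degree -sum1_card.
transitivity (\sum_(t in labels_at k) \sum_(pq : 'I_l * 'I_l)
   ((S.1 pq.1 == r t.1.2 t.1.1) && (S.2 pq.2 == r t.2 t.1.1)))%N; last first.
  by apply: eq_bigr => t _; rewrite pair_big.
rewrite exchange_big (pair_big predT (mem (labels_at k))) /=.
rewrite big_mkcond [RHS]big_mkcond; apply: eq_bigr => y _; rewrite inE /applies.
by case: (y.2 \in labels_at k) => //=; case: (_ && _).
Qed.

Lemma sum_colour_degree k y : (0 < l)%N ->
  n%:R ^+ 4 * (\sum_(S | applies r y S) colour_degree r k S)%:R
    <= n%:R ^+ (2 * l) * (n%:R * (6 * m%:R * l%:R ^+ 2 + 2 * Delta * n%:R)).
Proof.
move=> l0; under eq_bigr do rewrite colour_degreeE.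
have := sum_pin_labels (labels_at k) (fun t => r t.1.2 t.1.1)
  (fun t => r t.2 t.1.1) y.1.1 y.1.2 (r y.2.1.2 y.2.1.1) (r y.2.2 y.2.1.1).
set a := r _ _; set c := r y.2.2 _.
rewrite -(ler_nat R) !natrM !natrX => H; apply: le_trans H _.
rewrite ler_wpM2l ?exprn_ge0 //.
(* Expanding the product sorts labels by which pinned entries they match: no condition for [x1], one
   match for [x2] and [x3], both for [x4]. *)
pose x1 := #|labels_at k|.
pose x2 := #|[set t in labels_at k | r t.1.2 t.1.1 == a]%SET|.
pose x3 := #|[set t in labels_at k | r t.2 t.1.1 == c]%SET|.
pose x4 := #|[set t in labels_at k |
  (r t.1.2 t.1.1 == a) && (r t.2 t.1.1 == c)]%SET|.
have -> : (\sum_(t in labels_at k) (l + n * (a == r t.1.2 t.1.1)) *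
      (l + n * (c == r t.2 t.1.1)) =
    l ^ 2 * x1 + l * n * x2 + l * n * x3 + n ^ 2 * x4)%N.
  have cE (P : pred label) :
      #|[set t in labels_at k | P t]%SET| = (\sum_(t in labels_at k) P t)%N.
    rewrite -sum1_card big_mkcond [RHS]big_mkcond; apply: eq_bigr => t _.
    by rewrite inE; case: (t \in labels_at k) => //=; case: (P t).
  rewrite /x1 /x2 /x3 /x4 !cE -sum1_card !big_distrr -!big_split /=; apply: eq_bigr => t _.
  rewrite [a == _]eq_sym [c == _]eq_sym -mulnb.
  by move: (nat_of_bool _) (nat_of_bool _) => x z; ring.
have h1 : (x1 <= 2 * m * n)%N := card_labels_at k.
have h2 : (x2 <= 2 * m)%N := card_labels_at_fst k a.
have h3 : (x3 <= 2 * m)%N := card_labels_at_snd k c.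
have h4 : x4%:R <= 2 * Delta := card_labels_at_pair k a c.
move: x1 x2 x3 x4 h1 h2 h3 h4 => x1 x2 x3 x4.
rewrite -!(ler_nat R) !natrM => h1 h2 h3 h4; rewrite !natrD !natrM.
have l1 : 1 <= l%:R :> R by rewrite ler1n.
have e1 : l%:R ^+ 2 * x1%:R <= l%:R ^+ 2 * (2 * m%:R * n%:R) :> R.
  by rewrite ler_wpM2l ?exprn_ge0.
have e2 : l%:R * n%:R * x2%:R <= l%:R * n%:R * (2 * m%:R) :> R.
  by apply: ler_wpM2l h2; rewrite mulr_ge0.
have e3 : l%:R * n%:R * x3%:R <= l%:R * n%:R * (2 * m%:R) :> R.
  by apply: ler_wpM2l h3; rewrite mulr_ge0.
have e4 : n%:R ^+ 2 * x4%:R <= n%:R ^+ 2 * (2 * Delta).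
  by rewrite ler_wpM2l ?exprn_ge0.
(* As [l >= 1], the mixed terms [4 m l n] are absorbed into [4 m l^2 n]; with the [2 m l^2 n] from
   [x1] this makes the coefficient 6. *)
have e5 : l%:R * (n%:R * m%:R) <= l%:R ^+ 2 * (n%:R * m%:R) :> R.
  by rewrite ler_wpM2r ?mulr_ge0 // expr2 ler_peMl.
by move: e1 e2 e3 e4 e5; lra.
Qed.

(* Markov's inequality for the colour degree at a random edge. *)
Lemma card_overloaded_edges (B : R) (col : label -> 'I_m) :
  (0 < l)%N -> (0 < n)%N -> 0 < Delta ->
  B * n%:R = 8 * (6 * m%:R * l%:R ^+ 2 + 2 * Delta * n%:R) ->
  8 * #|[set e in edges r | B < (colour_degree r (col e.1.2) e.2)%:R]%SET|%:R
    <= #|edges r|%:R :> R.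
Proof.
move=> l0 n0 D0 BE; set bad := [set e in _ | _]%SET.
have nR0 : 0 < n%:R :> R by rewrite ltr0n.
have B0 : 0 < B.
  have h : 0 < 2 * Delta * n%:R by rewrite mulr_gt0 // mulr_gt0.
  have h' : 0 <= 6 * m%:R * l%:R ^+ 2 :> R by rewrite mulr_ge0 ?exprn_ge0 ?mulr_ge0.
  by rewrite -(pmulr_lgt0 _ nR0) BE mulr_gt0 // ltr_wpDl.
have h1 : B * #|bad|%:R <=
    (\sum_(e in edges r) colour_degree r (col e.1.2) e.2)%:R.
  rewrite natr_sum mulr_natr -sumr_const.
  apply: (@le_trans _ _ (\sum_(e in bad) (colour_degree r (col e.1.2) e.2)%:R)).
    by apply: ler_sum => e; rewrite inE => /andP[_ /ltW].
  rewrite [leLHS]big_mkcond [leRHS]big_mkcond; apply: ler_sum => e _.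
  by rewrite inE; case: (e \in edges r) => //=; case: ifP.
have h2 : n%:R ^+ 4 *
    (\sum_(e in edges r) colour_degree r (col e.1.2) e.2)%:R <=
    (l ^ 2 * #|labels|)%:R * (n%:R ^+ (2 * l) * (n%:R * (B * n%:R / 8))).
  rewrite sum_edges -card_positions_labels !natr_sum mulr_sumr mulr_suml.
  apply: ler_sum => y _; rewrite mul1r.
  apply: le_trans (sum_colour_degree (col y.2) y l0) _.
  by rewrite BE le_eqVlt; apply/orP; left; apply/eqP; field.
have ce : n%:R ^+ 2 * #|edges r|%:R
    = (l ^ 2 * #|labels|)%:R * n%:R ^+ (2 * l) :> R.
  by rewrite -!natrX -[LHS]natrM card_edges natrM.
have {}h2 : n%:R ^+ 4 * (B * #|bad|%:R) <=
    n%:R ^+ 4 * (B * (#|edges r|%:R / 8)).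
  apply: le_trans (ler_wpM2l _ h1) _; first by rewrite exprn_ge0.
  apply: le_trans h2 _.
  rewrite mulrA -ce.
  by rewrite le_eqVlt; apply/orP; left; apply/eqP; field.
rewrite ler_pM2l ?exprn_gt0 // ler_pM2l // in h2.
by move: h2; lra.
Qed.

End SecondMoment.
End Kikuchi.

(** * The potential on the Kikuchi graph and the resulting bound on labels *)

Lemma F2_rowDD (m : nat) (x : 'rV['F_2]_m) : x + x = 0.
Proof.
apply/rowP => k; rewrite !mxE.
by case: (x 0 k) => [[|[|?]] ?] //; exact: val_inj.
Qed.

Definition update (V : finType) (l : nat) (S : {ffun 'I_l -> V}) (p : 'I_l)
    (b : V) : {ffun 'I_l -> V} :=
  [ffun q => if q == p then b else S q].

Lemma sum_update (V : finType) (l m : nat) (v : V -> 'rV['F_2]_m)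
    (S : {ffun 'I_l -> V}) p b :
  \sum_q v (update S p b q) = \sum_q v (S q) + (v (S p) + v b).
Proof.
rewrite (bigD1 p) // [in RHS](bigD1 p) //= ffunE eqxx.
rewrite (eq_bigr (fun q => v (S q))); last first.
  by move=> q /negPf qp; rewrite ffunE qp.
set X := \sum_(q | _) _; rewrite [v (S p) + X]addrC -addrA.
by rewrite [v (S p) + (_ + _)]addrA F2_rowDD add0r addrC.
Qed.

Section KikuchiGraph.
Variables (R : realType) (V : finType) (m l : nat) (v : V -> 'rV['F_2]_m).
Variables (U : 'I_m -> {set V}) (s : 'I_m -> V -> V) (Delta : R).
Hypothesis Us : forall i, triple_system v i (U i) (s i).
Hypothesis sD : forall x y, (codegree U s x y)%:R <= Delta.
Local Notation n := #|V|.
Local Notation state := ({ffun 'I_l -> V} * {ffun 'I_l -> V})%type.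
Local Notation edge := ('I_l * 'I_l * (V * 'I_m * 'I_m) * state)%type.

(** On [U i] this is the inverse of the rotation. Reversing an edge for [s] therefore gives an edge
    for [s2] with the same label, and degrees at targets become degrees at sources. *)
Let s2 i x := s i (s i x).

Let s2I i : {in U i &, injective (s2 i)}.
Proof.
move=> x y xU yU; have [sx _ _] := Us xU; have [sy _ _] := Us yU.
by move=> /(triple_system_inj (@Us i) sx sy); exact: (triple_system_inj (@Us i)).
Qed.

Let s2D x y : (codegree U s2 x y)%:R <= Delta.
Proof.
apply: le_trans (sD y x); rewrite ler_nat; apply: subset_leq_card.
apply/fintype.subsetP => i; rewrite !inE => /andP[xU /eqP <-].
have [sx sss _] := Us xU; have [ssx _ _] := Us sx.
by rewrite ssx sss eqxx.
Qed.

Definition potential (S : state) : 'rV['F_2]_m :=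
  \sum_p v (S.1 p) + \sum_q v (S.2 q).

Definition target (e : edge) : state :=
  (update e.2.1 e.1.1.1 (s e.1.2.1.2 (s e.1.2.1.2 e.1.2.1.1)),
   update e.2.2 e.1.1.2 (s e.1.2.2 (s e.1.2.2 e.1.2.1.1))).

(** Replacing the second point of a triple by the third changes the sum by [e_i + v u]. Both triples
    contain [u], so the two copies of [v u] cancel. *)
Lemma potential_target e : e \in edges l U s ->
  potential (target e)
    = potential e.2 + (delta_mx 0 e.1.2.1.2 + delta_mx 0 e.1.2.2).
Proof.
case: e => [[[p q] [[u i] j]] [S1 S2]]; rewrite !inE /applies /=.
move=> /andP[/and3P[uUi uUj _] /andP[/eqP eS1 /eqP eS2]].
rewrite /potential /target /= !sum_update eS1 eS2.
have [_ _ <-] := Us uUi; have [_ _ <-] := Us uUj.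
rewrite -[v u + v (s i u) + _]addrA -[v u + v (s j u) + _]addrA.
set a := v _ + v _; set c := v (s j u) + _.
rewrite addrACA; congr (_ + _).
by rewrite [RHS]addrACA F2_rowDD add0r.
Qed.

Lemma colour_of_edge e k : e \in edges l U s ->
  potential e.2 0 k != potential (target e) 0 k ->
  e.1.2 \in labels_at U k.
Proof.
move=> eE; rewrite (potential_target eE) !mxE => H.
have := eE; rewrite inE => /andP[el _]; rewrite inE el /=.
apply: contraNT H; rewrite negb_or => /andP[ik jk].
by rewrite ![k == _]eq_sym (negPf ik) (negPf jk) !addr0.
Qed.

Let flip (e : edge) : edge := (e.1, target e).

Let flip_edges e : e \in edges l U s -> flip e \in edges l U s2.
Proof.
by rewrite inE => /andP[el _]; rewrite inE el /applies /= !ffunE !eqxx.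
Qed.

Let flipI : {in edges l U s &, injective flip}.
Proof.
have updateI (S S' : {ffun 'I_l -> V}) p b :
    S p = S' p -> update S p b = update S' p b -> S = S'.
  move=> Sp /ffunP SS'; apply/ffunP => q; have := SS' q; rewrite !ffunE.
  by case: eqP => [->|].
move=> [y [S1 S2]] [y' [S1' S2']]; rewrite !inE /applies /=.
move=> /andP[_ /andP[/eqP e1 /eqP e2]] /andP[_ /andP[/eqP e1' /eqP e2']].
rewrite /flip /target /= => -[? T1 T2]; subst y'.
by rewrite (updateI _ _ _ _ _ T1) ?e1 ?e1' // (updateI _ _ _ _ _ T2) ?e2 ?e2'.
Qed.

(** Edges are deleted if either end is overloaded in either colour of the edge. Each of these four
    classes has at most an eighth of the edges, so half survive, and [edge_isoperimetry] with
    [D = B] applies to them on [n ^ (2 l)] vertices. *)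
Lemma kikuchi_bound : (0 < l)%N -> (1 < n)%N -> 0 < Delta ->
  l%:R * #|labels U|%:R <=
    64 * n%:R * log2 (n%:R : R) * (6 * m%:R * l%:R ^+ 2 + 2 * Delta * n%:R).
Proof.
move=> l0 n1 D0; have n0 := ltnW n1.
have nR0 : 0 < n%:R :> R by rewrite ltr0n.
(* Eight times the bound on the mean colour degree at a random edge, so Markov's inequality loses an
   eighth. *)
pose B : R := 8 * (6 * m%:R * l%:R ^+ 2 + 2 * Delta * n%:R) / n%:R.
have BE : B * n%:R = 8 * (6 * m%:R * l%:R ^+ 2 + 2 * Delta * n%:R).
  by rewrite /B divfK // gt_eqF.
have B0 : 0 <= B.
  by rewrite /B divr_ge0 ?mulr_ge0 ?addr_ge0 ?mulr_ge0 // ltW.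
pose bad r col := [set e in edges l U r |
  B < (colour_degree U r (col e.1.2) e.2)%:R]%SET.
pose c1 (t : V * 'I_m * 'I_m) := t.1.2; pose c2 (t : V * 'I_m * 'I_m) := t.2.
have bad_s col : 8 * #|bad s col|%:R <= #|edges l U s|%:R :> R.
  exact: (card_overloaded_edges (fun i => triple_system_inj (@Us i)) sD).
have ees2 : #|edges l U s2| = #|edges l U s|.
  apply/eqP; rewrite -(@eqn_pmul2l (n ^ 2)) ?expn_gt0 ?n0 //.
  by rewrite !card_edges.
have bad_t col : 8 * #|[set e in edges l U s | flip e \in bad s2 col]%SET|%:R
    <= #|edges l U s|%:R :> R.
  rewrite -ees2.
  apply: le_trans (card_overloaded_edges s2I s2D col l0 n0 D0 BE).
  rewrite ler_pM2l // ler_nat -(card_in_imset (f := flip)); last first.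
    move=> e e'; rewrite inE => /andP[eE _]; rewrite inE => /andP[eE' _].
    exact: flipI.
  apply: subset_leq_card; apply/fintype.subsetP => _ /imsetP[e + ->].
  by rewrite inE => /andP[].
pose G := [set e in edges l U s | [&& e \notin bad s c1, e \notin bad s c2,
  flip e \notin bad s2 c1 & flip e \notin bad s2 c2]]%SET.
have cG : #|edges l U s|%:R <= 2 * #|G|%:R :> R.
  have : (#|edges l U s| <= #|G| + (#|bad s c1| + #|bad s c2| +
      (#|[set e in edges l U s | flip e \in bad s2 c1]%SET| +
       #|[set e in edges l U s | flip e \in bad s2 c2]%SET|)))%N.
    apply: leq_trans
      (leq_add (leqnn _) (leq_add (leq_card_setU _ _) (leq_card_setU _ _))).
    apply: leq_trans (leq_add (leqnn _) (leq_card_setU _ _)).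
    apply: leq_trans (leq_card_setU _ _).
    apply: subset_leq_card; apply/fintype.subsetP => e eE.
    rewrite !finset.in_setU.
    have [|b1] := boolP (e \in bad s c1); first by rewrite !orbT.
    have [|b2] := boolP (e \in bad s c2); first by rewrite !orbT.
    rewrite [e \in [set _ in _ | flip _ \in bad s2 c1]%SET]inE.
    rewrite [e \in [set _ in _ | flip _ \in bad s2 c2]%SET]inE.
    rewrite [e \in G]inE eE b1 b2 /=.
    by case: (flip e \in bad s2 c1); case: (flip e \in bad s2 c2).
  rewrite -(ler_nat R) !natrD.
  by move: (bad_s c1) (bad_s c2) (bad_t c1) (bad_t c2); lra.
(* If some edge [e0] of [Q] exists, [k] is one of its two colours. Since [e0] was kept, the colour
   degree of [k] at [x] is at most [B], and this colour degree counts all of [Q]. *)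
have deg r (F : edge -> edge) (x : state) k (Q : {set edge}) :
    {in Q &, injective F} ->
    (forall e, e \in Q -> [/\ F e \in edges l U r, (F e).2 = x,
        (F e).1.2 \in labels_at U k, F e \notin bad r c1 & F e \notin bad r c2]) ->
    #|Q|%:R <= B.
  move=> FI HQ; have [->|[e0 e0Q]] := set_0Vmem Q; first by rewrite cards0.
  apply: (@le_trans _ _ (colour_degree U r k x)%:R).
    rewrite ler_nat -(card_in_imset (f := fun e => (F e).1)); last first.
      move=> e e' eQ eQ' H; apply: FI => //.
      have [_ ex _ _ _] := HQ e eQ; have [_ ex' _ _ _] := HQ e' eQ'.
      by rewrite [F e]surjective_pairing [F e']surjective_pairing ex ex' H.
    apply: subset_leq_card; apply/fintype.subsetP => _ /imsetP[e eQ ->].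
    have [eE <- el _ _] := HQ e eQ; rewrite inE el /=.
    by move: eE; rewrite inE => /andP[].
  have [eE <- + b1 b2] := HQ e0 e0Q; rewrite inE => /andP[_ /orP[] /eqP <-].
    by move: b1; rewrite inE eE /= -leNgt.
  by move: b2; rewrite inE eE /= -leNgt.
have GE e : e \in G -> [/\ e \in edges l U s, e \notin bad s c1, e \notin bad s c2,
    flip e \notin bad s2 c1 & flip e \notin bad s2 c2].
  by rewrite inE => /andP[? /and4P[]].
have : #|G|%:R <= 2 * B * (#|[set: state]|%:R * log2 (#|[set: state]|%:R : R)).
  have -> : #|G| = #|[set e in G | (e.2 \in [set: state]) &&
      (target e \in [set: state])]%SET|.
    by apply: eq_card => e; rewrite [in RHS]inE !finset.in_setT !andbT.
  apply: (edge_isoperimetry (f := potential)) => //.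
  - move=> x k; apply: (deg s id x k) => // e; rewrite inE.
    move=> /andP[/GE[eE b1 b2 _ _] /andP[/eqP ex ek]]; split=> //.
    exact: (colour_of_edge eE ek).
  - move=> x k; apply: (deg s2 flip x k).
      move=> e e'.
      rewrite inE => /andP[/GE[eE _ _ _ _] _].
      by rewrite inE => /andP[/GE[eE' _ _ _ _] _]; exact: flipI.
    move=> e; rewrite inE => /andP[/GE[eE _ _ b1 b2] /andP[/eqP ex ek]]; split=> //.
      exact: flip_edges.
    exact: (colour_of_edge eE ek).
  - move=> e /GE[eE _ _ _ _]; rewrite (potential_target eE).
    apply/eqP => /rowP/(_ e.1.2.2)/eqP; rewrite !mxE !eqxx.
    move: eE; rewrite !inE => /andP[/and3P[_ _ /negPf ij] _].
    rewrite [e.1.2.2 == _]eq_sym ij add0r -subr_eq0 opprD addrA subrr add0r.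
    by rewrite oppr_eq0 oner_eq0.
rewrite cardsT card_prod card_ffun card_ord -expnD addnn -mul2n natrX log2X //.
have ce : n%:R ^+ 2 * #|edges l U s|%:R
    = l%:R ^+ 2 * #|labels U|%:R * n%:R ^+ (2 * l) :> R.
  by rewrite -!natrX -[LHS]natrM card_edges !natrM.
move=> GN.
set N := n%:R ^+ (2 * l) in ce GN; set L := log2 _ in GN *.
have N0 : 0 < N by rewrite exprn_gt0.
have lR0 : 0 < l%:R :> R by rewrite ltr0n.
have H : l%:R * N * (l%:R * #|labels U|%:R) <=
    l%:R * N * (64 * n%:R * L * (6 * m%:R * l%:R ^+ 2 + 2 * Delta * n%:R)).
  apply: (@le_trans _ _ (n%:R ^+ 2 * (2 * (2 * B * (N * ((2 * l)%:R * L)))))).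
    have -> : l%:R * N * (l%:R * #|labels U|%:R) = n%:R ^+ 2 * #|edges l U s|%:R.
      by rewrite ce; ring.
    rewrite ler_wpM2l ?exprn_ge0 //; apply: le_trans cG _.
    by rewrite ler_wpM2l.
  rewrite le_eqVlt; apply/orP; left; apply/eqP.
  have -> : 6 * m%:R * l%:R ^+ 2 + 2 * Delta * n%:R = B * n%:R / 8.
    by rewrite BE; field.
  by rewrite natrM; field.
by rewrite ler_pM2l ?mulr_gt0 // in H.
Qed.

End KikuchiGraph.

(** * Lower bound on the number of labels and choice of the sequence length *)

Lemma sum_sqr_leq (I : finType) (d : I -> nat) :
  ((\sum_u d u) ^ 2 <= #|I| * \sum_u d u ^ 2)%N.
Proof.
rewrite -(@leq_pmul2l 2) //.
have -> : (2 * (\sum_u d u) ^ 2 = \sum_u \sum_w 2 * (d u * d w))%N.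
  rewrite expnS expn1 big_distrl big_distrr; apply: eq_bigr => u _ /=.
  by rewrite !big_distrr.
apply: (@leq_trans (\sum_u \sum_w (d u ^ 2 + d w ^ 2))%N).
  by apply: leq_sum => u _; apply: leq_sum => w _; rewrite nat_Cauchy.
apply: eq_leq; under eq_bigr do rewrite big_split sum_nat_const /=.
by rewrite big_split sum_nat_const -big_distrr /=; ring.
Qed.

(** Cauchy-Schwarz on the number of colours at each point. The squares count ordered pairs of
    colours, and the pairs of equal colours account for the extra sum. *)
Lemma card_labels_lower (V : finType) (m : nat) (U : 'I_m -> {set V}) :
  ((\sum_i #|U i|) ^ 2 <= #|V| * (#|labels U| + \sum_i #|U i|))%N.
Proof.
pose d u := #|[set i | u \in U i]%SET|.
have dE : (\sum_i #|U i| = \sum_u d u)%N.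
  have cE (T : finType) (P : pred T) : #|[set x | P x]%SET| = (\sum_x P x)%N.
    rewrite -sum1_card big_mkcond; apply: eq_bigr => x _.
    by rewrite inE; case: (P x).
  rewrite /d; under [RHS]eq_bigr do rewrite cE.
  rewrite exchange_big; apply: eq_bigr => i _; rewrite -cE.
  by apply: eq_card => u; rewrite inE.
have d2 : (\sum_u d u ^ 2 <= #|labels U| + \sum_i #|U i|)%N.
  pose Q := [set t : V * 'I_m * 'I_m | (t.1.1 \in U t.1.2) && (t.1.1 \in U t.2)]%SET.
  pose D := [set t : V * 'I_m * 'I_m | (t.1.1 \in U t.1.2) && (t.1.2 == t.2)]%SET.
  have -> : (\sum_u d u ^ 2 = #|Q|)%N.
    rewrite -sum1_card (partition_big (fun t => t.1.1) predT) //=.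
    apply: eq_bigr => u _; rewrite sum1_card expnS expn1 -cardsX.
    rewrite -[LHS](card_imset _
      (f := fun ij : 'I_m * 'I_m => (u, ij.1, ij.2))); last first.
      by move=> [i j] [i' j'] [-> ->].
    apply: eq_card => -[[w i] j]; apply/imsetP/idP.
      move=> [[i' j']]; rewrite !inE /= => /andP[ui uj] [-> -> ->].
      by rewrite unfold_in /= inE /= ui uj eqxx.
    rewrite unfold_in /= inE /= => /andP[/andP[ui uj] /eqP <-].
    by exists (i, j) => //; rewrite !inE ui uj.
  have <- : (#|D| = \sum_i #|U i|)%N.
    rewrite -sum1_card (partition_big (fun t => t.2) predT) //=.
    apply: eq_bigr => i _; rewrite sum1_card.
    rewrite -[RHS](card_imset _ (f := fun u => (u, i, i))); last by move=> u u' [].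
    apply: eq_card => -[[w j] k]; apply/idP/imsetP.
      rewrite unfold_in /= inE /= => /andP[/andP[wj /eqP jk] /eqP ki].
      by subst j k; exists w.
    by move=> [u ui [-> -> ->]]; rewrite unfold_in /= inE /= ui !eqxx.
  apply: leq_trans (leq_card_setU _ _); apply: subset_leq_card.
  apply/fintype.subsetP => t; rewrite !inE => /andP[-> ->] /=.
  by case: (t.1.2 == t.2).
rewrite dE in d2 *; apply: leq_trans (leq_mul (leqnn _) d2).
exact: sum_sqr_leq.
Qed.

(* Once [m] exceeds a multiple of [L / eta ^ 2], the sequence length [l] is
   chosen so that the first term of the bound in [kikuchi_bound] is absorbed by
   the left-hand side. *)
Lemma triple_systems_bound (R : realType) (V : finType) (m : nat)
    (v : V -> 'rV['F_2]_m) (U : 'I_m -> {set V}) (s : 'I_m -> V -> V) (eta : R) :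
  (1 < #|V|)%N -> 0 < eta -> eta <= 1 ->
  (forall i, triple_system v i (U i) (s i)) ->
  (forall i, eta * #|V|%:R <= #|U i|%:R) ->
  let L : R := log2 #|V|%:R in
  let q : R := 2 ^+ 10 in
  6 * q * L < m%:R * eta ^+ 2 ->
  m%:R ^+ 3 * eta ^+ 4 <= 12 * q * (24 * q) * #|V|%:R * L ^+ 3.
Proof.
move=> n1 eta0 eta1 Us Ueta L q mL.
have qE : q = 32 * 32 by rewrite /q; ring.
move: q qE mL => q qE mL.
have q0 : 0 < q by rewrite qE mulr_gt0.
have [U' [U's U'D U'c]] := light_triple_system R n1 Us.
rewrite -/L in U'D U'c.
have := card_labels_lower U'; rewrite -(ler_nat R) natrX natrM natrD.
set t := ((\sum_i #|U' i|)%N%:R : R) in U'c *; set K := (#|labels U'|%:R : R) => tK.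
have L1 : 1 <= L by rewrite -(log2_2 R); apply: log2_le => //; rewrite ler_nat.
have n0 : 0 < #|V|%:R :> R by rewrite ltr0n ltnW.
set n := (#|V|%:R : R) in n0 U'c tK Ueta *.
have L0 : 0 < L by lra.
have meta : m%:R * eta ^+ 2 <= m%:R * eta.
  by rewrite ler_wpM2l // expr2 ler_piMl // ltW.
(* The loss of [36 n L] points is at most half of the total, because [6 q L < m eta^2 <= m eta]. *)
have t1 : m%:R * eta * n / 2 <= t.
  have : m%:R * (eta * n) <= (\sum_i #|U i|)%N%:R.
    rewrite natr_sum mulr_natl -[X in _ *+ X](card_ord m) -sumr_const.
    by apply: ler_sum => i _; exact: Ueta.
  have : 6 * q * L * n <= m%:R * eta * n by rewrite ler_pM2r //; lra.
  have : 0 < L * n by rewrite mulr_gt0.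
  by move: U'c; rewrite qE; lra.
(* This makes the diagonal term [n t] in [tK] at most [t^2 / 2]. *)
have t2 : 2 * n <= t.
  apply: le_trans t1; have : 6 * q * n <= m%:R * eta * n.
    rewrite ler_pM2r //; apply: le_trans meta; apply: le_trans (ltW mL).
    by rewrite ler_peMr // ?mulr_ge0 // ltW.
  by move: n0; rewrite qE; lra.
have K1 : m%:R ^+ 2 * eta ^+ 2 * n / 8 <= K.
  have t0 : 0 <= t by apply: le_trans t2; rewrite mulr_ge0 // ltW.
  have h : t ^+ 2 / 2 <= n * K.
    by have := ler_wpM2r t0 t2; move: tK; rewrite mulrDr !expr2; lra.
  have h' : (m%:R * eta * n / 2) ^+ 2 <= t ^+ 2.
    rewrite ler_sqr ?nnegrE // divr_ge0 // mulr_ge0 ?mulr_ge0 //; exact: ltW.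
  rewrite -(ler_pM2l n0); apply: le_trans h.
  by move: h'; rewrite !expr2; lra.
have qL0 : 0 < 6 * q * L by apply: mulr_gt0 => //; exact: mulr_gt0.
(* For [l <= y] the term [64 * 6 n L m l^2] is at most [l m^2 eta^2 n / 16], half of the lower bound
   for [l K]. Since [y > 1], its integer part [l] is positive and satisfies [y <= 2 l]. *)
pose y := m%:R * eta ^+ 2 / (6 * q * L).
have yE : y * (6 * q * L) = m%:R * eta ^+ 2.
  by rewrite /y divfK // gt_eqF.
have y1 : 1 < y by rewrite /y ltr_pdivlMr ?mul1r.
pose l := Num.trunc y.
have /andP[ly yl] := truncn_itv (ltW (lt_trans ltr01 y1)).
rewrite -/l in ly yl.
have l0 : (0 < l)%N by rewrite truncn_gt0 ltW.
have l1 : 1 <= l%:R :> R by rewrite ler1n.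
have := kikuchi_bound U's U'D l0 n1 _.
rewrite -/n -/L -/K => /(_ (mulr_gt0 (ltr0n R 12) L0)) kb.
have h1 : l%:R * (m%:R ^+ 2 * eta ^+ 2 * n / 8) <= l%:R * K by rewrite ler_wpM2l.
have h2 : (m%:R * l%:R * L) * l%:R <= (m%:R * l%:R * L) * y.
  by apply: ler_wpM2l ly; exact: mulr_ge0 (mulr_ge0 _ _) (ltW L0).
have h3 : n * (l%:R * m%:R ^+ 2 * eta ^+ 2) <= n * (24 * q * n * L ^+ 2).
  have e2 : n * (m%:R * l%:R * L * l%:R) <= n * (m%:R * l%:R * L * y).
    by rewrite ler_pM2l.
  have e3 : m%:R * l%:R * L * y = l%:R * m%:R * (m%:R * eta ^+ 2) / (6 * q).
    by rewrite -yE; field; rewrite gt_eqF.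
  rewrite e3 in e2.
  have {}kb := le_trans h1 kb.
  rewrite -subr_ge0 in kb; rewrite -subr_ge0 in e2; rewrite -subr_ge0.
  (* A nonnegative combination of the slacks of [kb] and [e2]; the terms in [l^2] cancel because
     [16 * 64 * 6 = 6 q]. *)
  pose x := 16 * (64 * n * L * (6 * m%:R * l%:R ^+ 2 + 2 * (12 * L) * n)
      - l%:R * (m%:R ^+ 2 * eta ^+ 2 * n / 8))
    + 6 * q * (n * (l%:R * m%:R * (m%:R * eta ^+ 2) / (6 * q))
      - n * (m%:R * l%:R * L * l%:R)).
  have x0 : 0 <= x by rewrite /x addr_ge0 // mulr_ge0 // mulr_ge0 // ltW.
  apply: le_trans x0 _; rewrite /x qE le_eqVlt; apply/orP; left; apply/eqP.
  by field.
rewrite ler_pM2l // in h3.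
have h4 : y <= 2 * l%:R by rewrite -natr1 in yl; lra.
have h5 : (m%:R ^+ 2 * eta ^+ 2 * (6 * q * L)) * y <=
    (m%:R ^+ 2 * eta ^+ 2 * (6 * q * L)) * (2 * l%:R).
  apply: ler_wpM2l h4; apply: mulr_ge0 (ltW qL0).
  by rewrite mulr_ge0 ?exprn_ge0 // ltW.
have h6 : (12 * q * L) * (l%:R * m%:R ^+ 2 * eta ^+ 2) <=
    (12 * q * L) * (24 * q * n * L ^+ 2).
  apply: ler_wpM2l h3; apply: mulr_ge0 (ltW L0).
  by rewrite mulr_ge0 // ltW.
have -> : m%:R ^+ 3 * eta ^+ 4 = m%:R ^+ 2 * eta ^+ 2 * (6 * q * L) * y.
  by rewrite -[RHS]mulrA [6 * q * L * y]mulrC yE; ring.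
apply: le_trans h5 _; apply: le_trans (_ : _ <= 12 * q * L * (24 * q * n * L ^+ 2)) _.
  by apply: le_trans h6; rewrite le_eqVlt; apply/orP; left; apply/eqP; ring.
by rewrite le_eqVlt; apply/orP; left; apply/eqP; ring.
Qed.

Theorem theorem1p2 (R : realType) (delta p : R) (m n : nat)
    (C : {linear 'rV['F_2]_m -> 'rV['F_2]_n}) :
  0 < delta -> 1 / 2 < p -> (1 < n)%N ->
  locally_decodable 3 delta p C ->
  m%:R <= (10 ^+ 7 / delta ^+ 2) * (n%:R `^ (1 / 3)) * log2 (n%:R : R).
Proof.
move=> delta0 p2 n1 Cdec; have n0 := ltnW n1.
have span := decodable_span p2 n0 Cdec.
have {span} sys i := decoding_triple_system (span i).
have [U Usys] := choice sys; have [s Us] := choice Usys.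
have n0R : 0 < n%:R :> R by rewrite ltr0n.
have c0 : 0 <= n%:R `^ (1 / 3) :> R by exact: powR_ge0.
have c3 : (n%:R `^ (1 / 3)) ^+ 3 = n%:R :> R.
  by rewrite -powR_mulrn // -powRrM mul1r mulVf ?pnatr_eq0 // powRr1 // ltW.
move: (n%:R `^ (1 / 3)) c0 c3 => c c0 c3.
have c1 : 1 <= c.
  by rewrite -(@ler_pXn2r _ 3) ?nnegrE // c3 expr1n ler1n.
have cV : #|{: 'I_n * bool}| = (2 * n)%N.
  by rewrite card_prod card_ord card_bool mulnC.
have LV : log2 (#|{: 'I_n * bool}|%:R : R) = 1 + log2 (n%:R : R).
  by rewrite cV natrM log2M // log2_2.
have L1 : 1 <= log2 (n%:R : R).
  by rewrite -[X in X <= _](log2_2 R); apply: log2_le => //; rewrite ler_nat.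
have V1 : (1 < #|{: 'I_n * bool}|)%N by rewrite cV; lia.
(* The padding doubles the number of points, so the density is [delta / 2]. *)
have U1 i : delta / 2 * #|{: 'I_n * bool}|%:R <= #|U i|%:R.
  rewrite cV natrM mulrA divfK ?pnatr_eq0 //.
  by have [_ /ltW] := Us i.
have := triple_systems_bound V1 _ _ (fun i => (Us i).1) U1.
rewrite LV; move: (log2 _) L1 => L L1.
have qE : 2 ^+ 10 = 32 * 32 :> R by ring.
have qT : 2 ^+ 10 * 2 ^+ 10 <= 10 ^+ 7 :> R.
  have : 8 ^+ 6 <= 10 ^+ 6 :> R by apply: lerXn2r; rewrite ?nnegrE //; lra.
  have -> : 2 ^+ 10 * 2 ^+ 10 = 4 * 8 ^+ 6 :> R by ring.
  have -> : 10 ^+ 7 = 10 * 10 ^+ 6 :> R by ring.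
  have : 0 <= 10 ^+ 6 :> R by rewrite exprn_ge0.
  by lra.
move: (2 ^+ 10) (10 ^+ 7) qE qT => q T qE qT tri.
have L0 : 0 < L by lra.
have q0 : 0 < q by rewrite qE mulr_gt0.
have T0 : 0 < T by apply: lt_le_trans qT; rewrite mulr_gt0.
have d2 : 0 < delta ^+ 2 by rewrite exprn_gt0.
have rhs0 : 0 <= T / delta ^+ 2 * c * L.
  by rewrite !mulr_ge0 ?invr_ge0 // ltW.
have [->//|m0] := posnP m.
(* More than [delta n] of the [2 n] points are covered for one index, which gives the requirement
   [eta <= 1]. *)
have delta2 : delta < 2.
  have [_ dU] := Us (Ordinal m0).
  have : delta * n%:R < 2 * n%:R.
    by apply: lt_le_trans dU _; rewrite -natrM -cV ler_nat max_card.
  by rewrite ltr_pM2r.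
(* For small [m], [m delta^2 <= 24 q (1 + L) <= 48 q L <= q^2 L <= T L], and the factor [c >= 1] is
   free. Otherwise [triple_systems_bound] applies and the claim is compared after cubing. *)
have [mL|mL] := leP (m%:R * (delta / 2) ^+ 2) (6 * q * (1 + L)).
  have -> : T / delta ^+ 2 * c * L = T * (c * L) / delta ^+ 2 by ring.
  rewrite ler_pdivlMr //.
  have h1 : T * L <= T * (c * L) by rewrite ler_pM2l // ler_peMl // ltW.
  have h2 : q * q * L <= T * L by rewrite ler_pM2r.
  have h3 : 48 * q * L <= q * q * L.
    by rewrite ler_pM2r // ler_pM2r // qE; lra.
  have h4 : 24 * q * 1 <= 24 * q * L by rewrite ler_pM2l // mulr_gt0.
  have -> : m%:R * delta ^+ 2 = 4 * (m%:R * (delta / 2) ^+ 2) by field.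
  by lra.
have {}tri : m%:R ^+ 3 * (delta / 2) ^+ 4 <=
    12 * q * (24 * q) * (2 * n)%:R * (1 + L) ^+ 3.
  by rewrite -cV; apply: tri => //; lra.
rewrite -(@ler_pXn2r _ 3) ?nnegrE //.
have -> : (T / delta ^+ 2 * c * L) ^+ 3
    = T ^+ 3 * (n%:R * L ^+ 3) / delta ^+ 6.
  by rewrite -c3; field; rewrite gt_eqF.
rewrite ler_pdivlMr ?exprn_gt0 //.
have nL0 : 0 < n%:R * L ^+ 3 by rewrite mulr_gt0 ?exprn_gt0.
have h1 : m%:R ^+ 3 * delta ^+ 6 <= 64 * (m%:R ^+ 3 * (delta / 2) ^+ 4).
  have -> : 64 * (m%:R ^+ 3 * (delta / 2) ^+ 4)
      = m%:R ^+ 3 * delta ^+ 4 * 2 ^+ 2 by field.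
  have -> : m%:R ^+ 3 * delta ^+ 6 = m%:R ^+ 3 * delta ^+ 4 * delta ^+ 2 by ring.
  apply: ler_wpM2l; first by rewrite mulr_ge0 ?exprn_ge0 // ltW.
  by rewrite ler_sqr ?nnegrE ?ltW.
have h2 : (1 + L) ^+ 3 <= (2 * L) ^+ 3.
  by rewrite ler_pXn2r ?nnegrE //; lra.
have h3 : 12 * q * (24 * q) * (2 * n)%:R * (1 + L) ^+ 3
    <= 12 * q * (24 * q) * (2 * n)%:R * (2 * L) ^+ 3.
  by rewrite ler_wpM2l // !mulr_ge0 // ltW.
(* The numerical factor is [64 * 12 * 24 * 2 * 8 = 288 q], so the claim reduces to [288 <= q^3] and
   [q^2 <= T]. *)
have h4 : 64 * (12 * q * (24 * q) * (2 * n)%:R * (2 * L) ^+ 3)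
    <= T ^+ 3 * (n%:R * L ^+ 3).
  have -> : 64 * (12 * q * (24 * q) * (2 * n)%:R * (2 * L) ^+ 3)
      = 288 * q ^+ 3 * (n%:R * L ^+ 3) by rewrite natrM qE; ring.
  rewrite ler_pM2r //; apply: (@le_trans _ _ ((q * q) ^+ 3)).
    have -> : (q * q) ^+ 3 = q ^+ 3 * q ^+ 3 by ring.
    rewrite ler_pM2r ?exprn_gt0 //; apply: (@le_trans _ _ (q ^+ 1)).
      by rewrite expr1 qE; lra.
    by apply: ler_weXn2l => //; rewrite qE; lra.
  by rewrite ler_pXn2r ?nnegrE ?mulr_ge0 // ltW.
by lra.
Qed.
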